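(* For all $\epsilon\in (0,1)$ and all integers $k\geq 2$, there is $p_0=p_0(k,\epsilon)$ such that the following holds. Suppose that $G=\mathbb{Z}/p\mathbb{Z}$ is a cyclic group of prime order $p\geq p_0$, and that $A\subseteq G$ is $k$-stable. Then either $|A|\leq \epsilon|G|$, or $|G\setminus A|\leq \epsilon|G|$.
   Context: Stability: for a group $G$ (written additively), $A\subseteq G$ and an integer $k\geq 2$, the set $A$ has the $k$-order property if there exist $a_1,\dots,a_k,b_1,\dots,b_k\in G$ such that $a_i+b_j\in A$ if and only if $i\leq j$. The set $A$ is $k$-stable if it does not have the $k$-order property. *)

(* Defs.v *)
From mathcomp Require Export all_boot all_order all_algebra.
From mathcomp Require Export reals.

Set Implicit Arguments.
Unset Strict Implicit.
Unset Printing Implicit Defensive.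

Import GRing.Theory.
Local Open Scope ring_scope.

(* The indices 1, ..., k are shifted to 0, ..., k - 1. *)
Definition has_order_property (G : zmodType) (k : nat) (A : {pred G}) : Prop :=
  exists a b : 'I_k -> G,
    forall i j : 'I_k, a i + b j \in A <-> (i <= j)%N.

Definition stable (G : zmodType) (k : nat) (A : {pred G}) : Prop :=
  ~ has_order_property k A.

(* Main.v *)
Require Import Defs.
From mathcomp Require Import all_fingroup lra.

(** Stability bounds the height of binary trees all of whose nodes split by
    translates of [A] (Hodges).  So, starting from [G] and repeatedly cutting a
    set [B] of density at least [c] into its parts inside and outside a
    translate of [A], with both parts of proportion at least [e <= c / 4], one
    soon reaches a [B] such that each [x + B] lies in [A], or outside [A], up
    to a proportion [e].  As [2 e] is below the density of [B], some [h != 0]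
    satisfies [#|B :&: (B - h)| > 2 e #|B|], and then [x + B] and [h + x + B]
    are on the same side of [A] for every [x].  Since [h] generates a group of
    prime order, all the translates of [B] are on the same side, and averaging
    over them shows that [A] or its complement has density at most [e]. *)

Set Implicit Arguments.
Unset Strict Implicit.
Unset Printing Implicit Defensive.

Import Order.TTheory GRing.Theory Num.Theory.
Local Open Scope ring_scope.

(** Different nodes of one level may use different [x]; every leaf must retain a point of [Y]. *)
Fixpoint has_tree (S T : finType) (e : S -> {set T}) (n : nat)
    (X : {set S}) (Y : {set T}) : Prop :=
  if n is n'.+1 then
    exists2 x, x \in X &
      has_tree e n' X (Y :&: e x) /\ has_tree e n' X (Y :\: e x)
  else exists y, y \in Y.

Lemma has_treeS (S T : finType) (e : S -> {set T}) n
    (X X' : {set S}) (Y Y' : {set T}) :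
  X \subset X' -> Y \subset Y' -> has_tree e n X Y -> has_tree e n X' Y'.
Proof.
move=> sX; elim: n Y Y' => [|n IHn] Y Y' sY /=.
  by case=> y Yy; exists y; apply: (subsetP sY).
case=> x Xx [t1 t0]; exists x; first exact: (subsetP sX).
split; first by apply: IHn t1; apply: setSI.
by apply: IHn t0; apply: setSD.
Qed.

Lemma has_tree_nonempty (S T : finType) (e : S -> {set T}) n
    (X : {set S}) (Y : {set T}) : has_tree e n X Y -> exists y, y \in Y.
Proof.
elim: n Y => [//|n IHn] Y /= [x _ [/IHn[y /setIP[Yy _]] _]].
by exists y.
Qed.

(** Induction on [m + n]. If the root lies in [X1], either some subtree already contains a tree of
    height [n] over [X2], or both contain one of height [m - 1] over [X1], and the root joins them.
    A root in [X2] is symmetric. *)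
Lemma has_treeU (S T : finType) (e : S -> {set T}) m n
    (X1 X2 : {set S}) (Y : {set T}) :
  has_tree e (m + n) (X1 :|: X2) Y -> has_tree e m X1 Y \/ has_tree e n X2 Y.
Proof.
move Ek: (m + n)%N => k; elim: k m n Ek Y => [|k IHk] m n Ek Y.
  by case: m n Ek => [|m] [|n] //= _; left.
move=> treeY; have [y0 Yy0] := has_tree_nonempty treeY.
case: m Ek => [_|m Ek]; first by left; exists y0.
case: n Ek => [_|n Ek]; first by right; exists y0.
case: treeY => x; case/setUP=> Xx [t1 t0].
  have Ek' : (m + n.+1 = k)%N by case: Ek.
  have [u1|u1] := IHk _ _ Ek' _ t1; last first.
    by right; apply: has_treeS u1 => //; apply: subsetIl.
  have [u0|u0] := IHk _ _ Ek' _ t0; last first.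
    by right; apply: has_treeS u0 => //; apply: subsetDl.
  by left; exists x.
have Ek' : (m.+1 + n = k)%N by case: Ek; rewrite addnS addSn.
have [u1|u1] := IHk _ _ Ek' _ t1.
  by left; apply: has_treeS u1 => //; apply: subsetIl.
have [u0|u0] := IHk _ _ Ek' _ t0.
  by left; apply: has_treeS u0 => //; apply: subsetDl.
by right; exists x.
Qed.

Definition half_graph (S T : finType) (e : S -> {set T}) (lt : rel nat)
    (n : nat) (X : {set S}) (Y : {set T}) : Prop :=
  exists (a : nat -> S) (b : nat -> T), forall i j, (i < n)%N -> (j < n)%N ->
    [/\ a i \in X, b j \in Y & (b j \in e (a i)) = lt i j].

Lemma half_graphS (S T : finType) (e : S -> {set T}) lt n
    (X X' : {set S}) (Y Y' : {set T}) :
  X \subset X' -> Y \subset Y' ->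
  half_graph e lt n X Y -> half_graph e lt n X' Y'.
Proof.
move=> sX sY [a [b ab]]; exists a, b => i j ni nj; have [? ? ?] := ab i j ni nj.
by split=> //; [apply: (subsetP sX) | apply: (subsetP sY)].
Qed.

(** In closed form [2 ^ n.+1 - 2]: half of each height leaves one level for a root and the previous
    height for the induction. *)
Definition tree_height (n : nat) : nat := iter n (fun m => m.+1.*2) 0%N.

(* Pick any [y] in [Y] and keep the half of [X] on which membership of [y] is
   constant.  Restricting [Y] to the opposite side of the root [x] of the
   remaining tree, the pair [(x, y)] becomes the last pair of a weak half graph
   or the first pair of a strict one. *)
Lemma has_tree_half_graph (S T : finType) (e : S -> {set T}) (x0 : S) (y0 : T)
    (s t : nat) (X : {set S}) (Y : {set T}) :
  has_tree e (tree_height (s + t)) X Y ->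
  half_graph e ltn s X Y \/ half_graph e leq t X Y.
Proof.
move Ek: (s + t)%N => k; elim: k s t Ek X Y => [|k IHk] s t Ek X Y.
  by case: s Ek => // _ _; left; exists (fun=> x0), (fun=> y0).
case: s Ek => [_ _|s Ek]; first by left; exists (fun=> x0), (fun=> y0).
case: t Ek => [_ _|t Ek]; first by right; exists (fun=> x0), (fun=> y0).
move=> treeXY; have [y Yy] := has_tree_nonempty treeXY.
have sX1 : X :&: [set x | y \in e x] \subset X by apply: subsetIl.
have sX0 : X :\: [set x | y \in e x] \subset X by apply: subsetDl.
move: treeXY; rewrite /tree_height iterS -addnn -/(tree_height k).
rewrite -{1}(setID X [set x | y \in e x]) => /has_treeU[].
  case=> x; rewrite !inE => /andP[Xx exy] [_ /IHk-/(_ s.+1 t)].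
  case=> [|hg|[a [b ab]]]; first by case: Ek; rewrite addnS addSn.
    by left; apply: half_graphS hg => //; apply: subsetDl.
  right; exists (fun i => if i == t then x else a i).
  exists (fun i => if i == t then y else b i) => i j.
  rewrite !ltnS => it jt.
  have [Ei|Ei] := eqVneq i t; have [Ej|Ej] := eqVneq j t.
  - by rewrite Ei Ej leqnn.
  - have jt' : (j < t)%N by rewrite ltn_neqAle Ej.
    have [_ + _] := ab j j jt' jt'; rewrite inE => /andP[/negPf bj Yb].
    by split=> //; rewrite bj Ei leqNgt jt'.
  - have it' : (i < t)%N by rewrite ltn_neqAle Ei.
    have [+ _ _] := ab i i it' it'; rewrite !inE => /andP[Xa ya].
    by split=> //; rewrite ya Ej it.
  - have it' : (i < t)%N by rewrite ltn_neqAle Ei.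
    have jt' : (j < t)%N by rewrite ltn_neqAle Ej.
    have [+ + ->] := ab i j it' jt'; rewrite !inE.
    by move=> /andP[Xa _] /andP[_ Yb].
case=> x; rewrite !inE => /andP[exy Xx] [/IHk-/(_ s t.+1)].
case=> [|[a [b ab]] _|hg _]; first by case: Ek.
  left; exists (fun i => if i is i'.+1 then a i' else x).
  exists (fun i => if i is i'.+1 then b i' else y) => -[|i] [|j] it jt.
  - by split=> //; apply: negPf.
  - have [_ + _] := ab j j jt jt; rewrite inE => /andP[Yb exb].
    by split.
  - have [+ _ _] := ab i i it it; rewrite !inE => /andP[/negPf ya Xa].
    by split.
  - have [+ + ->] := ab i j it jt; rewrite !inE.
    by move=> /andP[_ Xa] /andP[Yb _].
by right; apply: half_graphS hg => //; apply: subsetIl.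
Qed.

Definition translate (G : finZmodType) (A : {set G}) (x : G) : {set G} :=
  [set y | x + y \in A].

Lemma stable_no_tree (G : finZmodType) (k : nat) (A : {set G}) :
  stable k A -> ~ has_tree (translate A) (tree_height (k.+1 + k)) setT setT.
Proof.
move=> stA /(has_tree_half_graph 0 0)[] [a [b ab]]; apply: stA.
  (* Shifting [b] by one turns [i < j.+1] into [i <= j], at the cost of one extra pair: hence
     [k.+1]. *)
  exists (fun i => a i), (fun j => b j.+1) => i j.
  have [_ _] := ab i j.+1 (ltnW (ltn_ord i)) (ltn_ord j).
  by rewrite inE /= => ->.
exists (fun i => a i), (fun j => b j) => i j.
by have [_ _] := ab i j (ltn_ord i) (ltn_ord j); rewrite inE => ->.
Qed.

Lemma sum_card_translate (G : finZmodType) (A B : {set G}) :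
  (\sum_x #|B :&: translate A x| = #|B| * #|A|)%N.
Proof.
(* Double counting of the pairs with [y] in [B] and [x + y] in [A]. *)
transitivity (\sum_(y in B) \sum_x ((x + y)%R \in A))%N.
  rewrite exchange_big /=; apply: eq_bigr => x _.
  rewrite -sum1_card big_mkcond [RHS]big_mkcond /=.
  by apply: eq_bigr => y _; rewrite !inE; case: (y \in B); case: (_ \in A).
rewrite -sum_nat_const; apply: eq_bigr => y _.
rewrite (reindex_inj (addIr (- y))) -sum1_card [RHS]big_mkcond /=.
by apply: eq_bigr => x _; rewrite subrK; case: (_ \in A).
Qed.

Lemma translateC (G : finZmodType) (A : {set G}) (x : G) :
  translate (~: A) x = ~: translate A x.
Proof. by apply/setP=> y; rewrite !inE. Qed.

(** As [#|G|] is prime, [h] generates [G], so every [y] is reached from a point of [U] by repeatedly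
    adding [h]. *)
Lemma prime_shift_invariant (G : finZmodType) (h : G) (U : {set G}) :
  prime #|G| -> h != 0 -> (forall x, x \in U -> h + x \in U) ->
  U = set0 \/ U = setT.
Proof.
move=> prG h0 Uh; have [->|/set0Pn[x Ux]] := eqVneq U set0; first by left.
right; apply/setP=> y; rewrite inE.
have : <[h]>%g = [set: G].
  apply/eqP; rewrite eqEcard subsetT /= -orderE cardsT.
  have : (#[h]%g %| #|G|)%N by rewrite -cardsT cardSg ?subsetT.
  by case/primeP: prG => _ /[apply]/orP[]; rewrite ?order_eq1 ?(negPf h0) => // /eqP->.
move/setP/(_ (y - x)); rewrite inE => /cycleP[n yE].
rewrite -(subrK x y) yE FinRing.zmodXgE.
by elim: n {yE} => [|n IHn]; rewrite ?mulr0n ?add0r // mulrS -addrA Uh.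
Qed.

(* The set [U] of [x] for which [x + B] lies mostly in [A] is invariant under
   any [h] such that [B] and [B - h] overlap in more than [2 e #|B|] points. *)
Lemma good_set_dichotomy (R : realFieldType) (e : R) (G : finZmodType)
    (A B : {set G}) :
  prime #|G| -> (0 < #|B|)%N -> 0 <= e ->
  (e *+ 2) * #|G|%:R < #|B|%:R - 1 ->
  (forall x, #|B :&: translate A x|%:R < e * #|B|%:R
          \/ #|B :\: translate A x|%:R < e * #|B|%:R) ->
  #|A|%:R <= e * #|G|%:R \/ #|~: A|%:R <= e * #|G|%:R.
Proof.
move=> prG B_gt0 e_ge0 eG goodB.
have B_gt0' : 0 < #|B|%:R :> R by rewrite ltr0n.
have small (C : {set G}) :
    (forall x, #|B :&: translate C x|%:R < e * #|B|%:R) ->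
    #|C|%:R <= e * #|G|%:R.
  move=> smallC; rewrite -(ler_pM2l B_gt0') -natrM -sum_card_translate natr_sum.
  rewrite mulrCA mulrA mulr_natr -sumr_const.
  by apply: ler_sum => x _; apply: ltW.
(* The overlaps over all [h] sum to [#|B| ^ 2]; the [- 1] in the hypothesis pays for the term [#|B|]
   at [h = 0]. *)
have [h h0 hB] : exists2 h, h != 0 &
    (e *+ 2) * #|B|%:R < #|B :&: translate B h|%:R.
  have [h /andP[h0 hB]|noh] := pickP (fun h : G => (h != 0) &&
    ((e *+ 2) * #|B|%:R < #|B :&: translate B h|%:R)); first by exists h.
  have := sum_card_translate B B; rewrite (bigD1 0) //=.
  have -> : translate B 0 = B by apply/setP=> y; rewrite inE add0r.
  rewrite setIid => /(congr1 (fun n : nat => n%:R : R)).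
  rewrite natrD natr_sum natrM => sumB.
  have : \sum_(x | x != 0) #|B :&: translate B x|%:R
      <= \sum_(x : G) (e *+ 2) * #|B|%:R.
    rewrite [leRHS](bigD1 0) //= -[leLHS]add0r lerD ?mulr_ge0 ?mulrn_wge0 //.
    by apply: ler_sum => x x0; rewrite leNgt; have := noh x; rewrite x0 /= => ->.
  rewrite sumr_const -[_ *+ #|_|]mulr_natr mulrAC => le_sum.
  have : (e *+ 2) * #|G|%:R * #|B|%:R < (#|B|%:R - 1) * #|B|%:R.
    by rewrite ltr_pM2r.
  rewrite mulrBl mul1r -sumB addrC addKr.
  by move=> /(le_lt_trans le_sum); rewrite ltxx.
pose U := [set x | #|B :\: translate A x|%:R < e * #|B|%:R].
have Uh x : x \in U -> h + x \in U.
  rewrite !inE => Ux; have [Ahx|//] := goodB (h + x).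
  (* For [y] in the overlap, if [h + x + y] is in [A] then [Ahx] counts [y]; otherwise [Ux] counts
     [h + y]. *)
  have := hB; rewrite ltNge => /negP[].
  rewrite mulrnAl mulr2n; apply: le_trans (lerD (ltW Ahx) (ltW Ux)).
  rewrite -natrD ler_nat -(cardsID (translate A (h + x)) (_ :&: _)) leq_add //.
    by apply: subset_leq_card; apply: setSI; apply: subsetIl.
  rewrite -(card_imset _ (addrI h)); apply: subset_leq_card.
  apply/subsetP=> _ /imsetP[y + ->]; rewrite !inE.
  by case/and3P=> nA _ ->; rewrite addrA (addrC x) nA.
have [U0|UT] := prime_shift_invariant prG h0 Uh; [left|right]; apply: small => x.
  have [//|Ux] := goodB x; have : x \in U by rewrite inE.
  by rewrite U0 inE.
have : x \in U by rewrite UT inE.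
by rewrite inE translateC -setDE.
Qed.

(* The tolerance [e] must be small compared to the current density [c]; since
   the splitting depth is bounded, [e] may shrink along the iteration. *)
Lemma dense_dichotomy_or_tree (R : realType) (eps : R) (n : nat) (c : R) :
  0 < eps -> 0 < c ->
  exists p0 : nat, forall G : finZmodType, prime #|G| -> (p0 <= #|G|)%N ->
    forall A B : {set G}, c * #|G|%:R <= #|B|%:R ->
      [\/ has_tree (translate A) n setT B,
          #|A|%:R <= eps * #|G|%:R | #|~: A|%:R <= eps * #|G|%:R].
Proof.
move=> eps_gt0; elim: n c => [|n IHn] c c_gt0.
  exists 0%N => G prG _ A B cB; apply: Or31; apply/set0Pn.
  rewrite -card_gt0 -(ltr0n R); apply: lt_le_trans cB.
  by rewrite mulr_gt0 // ltr0n prime_gt0.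
(* With [c / 4], twice [e * #|G|] is at most [c * #|G| / 2], which is below [#|B| - 1] once
   [c * #|G| > 2]. *)
pose e := Num.min eps (c / 4).
have e_gt0 : 0 < e by rewrite lt_min eps_gt0 divr_gt0.
have e_eps : e <= eps by rewrite ge_min lexx.
have e_c : e <= c / 4 by rewrite ge_min lexx orbT.
have [p1 Hp1] := IHn (e * c) (mulr_gt0 e_gt0 c_gt0).
exists (maxn p1 (Num.truncn (2 / c)).+1) => G prG; rewrite geq_max => /andP[Gp1 Gc].
move=> A B cB; have G_gt0 : 0 < #|G|%:R :> R by rewrite ltr0n prime_gt0.
have cG : 2 < c * #|G|%:R.
  rewrite mulrC -ltr_pdivrMr //.
  by apply: lt_le_trans (truncnS_gt _) _; rewrite ler_nat.
have dense C : e * #|B|%:R <= C -> e * c * #|G|%:R <= C.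
  by apply: le_trans; rewrite -mulrA ler_pM2l.
have [x /andP[x1 x0]|goodB] := pickP (fun x =>
    (e * #|B|%:R <= #|B :&: translate A x|%:R) &&
    (e * #|B|%:R <= #|B :\: translate A x|%:R)).
  have [t1||] := Hp1 G prG Gp1 A _ (dense _ x1); try by constructor.
  have [t0||] := Hp1 G prG Gp1 A _ (dense _ x0); try by constructor.
  by apply: Or31; exists x; rewrite ?inE.
have eG : e * #|G|%:R <= c / 4 * #|G|%:R by rewrite ler_pM2r.
have [|||x|hA|hA] := @good_set_dichotomy R e G A B prG.
- by rewrite -(ltr0n R); lra.
- exact: ltW.
- by rewrite mulrnAl mulr2n; lra.
- by have /negbT := goodB x; rewrite negb_and -!ltNge => /orP.
- by apply: Or32; apply: le_trans hA _; rewrite ler_pM2r.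
- by apply: Or33; apply: le_trans hA _; rewrite ler_pM2r.
Qed.

Theorem corollary3 (R : realType) (eps : R) (k : nat)
    (eps_gt0 : 0 < eps) (eps_lt1 : eps < 1) (k_ge2 : (2 <= k)%N) :
  exists p0 : nat, forall p : nat, prime p -> (p0 <= p)%N ->
    forall A : {set 'Z_p}, stable k A ->
      #|A|%:R <= eps * #|'Z_p|%:R \/ #|~: A|%:R <= eps * #|'Z_p|%:R.
Proof.
have [p0 Hp0] := dense_dichotomy_or_tree (tree_height (k.+1 + k)) eps_gt0 ltr01.
exists p0 => p prp p0p A stA.
have cardZ : #|'Z_p| = p by rewrite card_ord Zp_cast ?prime_gt1.
have prZ : prime #|'Z_p| by rewrite cardZ.
have p0Z : (p0 <= #|'Z_p|)%N by rewrite cardZ.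
have [|/(stable_no_tree stA)//||] := Hp0 _ prZ p0Z A setT.
- by rewrite mul1r cardsT.
- by left.
- by right.
Qed.
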